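(* Let $G$ be a graph of order $n$ and let $\delta$ be the minimum degree of $G$. Then all roots of the total domination polynomial $D_t(G,x)$ lie in the circle with center $(-1,0)$ and radius $\sqrt[\delta]{2^n-1}$. In other words, if $D_t(G,z)=0$, then $|z+1|\le \sqrt[\delta]{2^n-1}$.
   Context: Graphs are simple; the order of a graph is its number of vertices. For a graph $G=(V,E)$ of order $n$, a set $D\subseteq V$ is a total dominating set if every vertex of $V$ is adjacent to some vertex of $D$. Let $d_t(G,i)$ be the number of total dominating sets of $G$ of cardinality $i$. The total domination polynomial of $G$ is $D_t(G,x)=\sum_{i=1}^n d_t(G,i)x^i$. Roots are complex numbers $z$, identified with points of the plane. *)

(* Defs.v *)
(* A simple graph is a symmetric irreflexive relation on a
   finType of vertices. *)
From mathcomp Require Import all_boot all_order all_algebra.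
From mathcomp Require Import reals complex.
Set Implicit Arguments.
Unset Strict Implicit.
Unset Printing Implicit Defensive.
Import GRing.Theory.
Local Open Scope ring_scope.

Definition degree (V : finType) (adj : rel V) (v : V) : nat :=
  #|[set u | adj v u]|.

(* In a nonempty simple graph every degree is less than #|V|, so the default
   value #|V| does not affect the minimum; the empty graph gets 0. *)
Definition min_degree (V : finType) (adj : rel V) : nat :=
  \big[minn/#|V|]_(v : V) degree adj v.

Definition total_dominating (V : finType) (adj : rel V) (D : {set V}) : bool :=
  [forall v, exists u in D, adj v u].

Definition num_total_dominating (V : finType) (adj : rel V) (i : nat) : nat :=
  #|[set D : {set V} | total_dominating adj D & #|D| == i]|.

Definition total_dom_poly (K : nzRingType) (V : finType) (adj : rel V) :
    {poly K} :=
  \sum_(1 <= i < #|V|.+1) (num_total_dominating adj i)%:R *: 'X^i.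

(* Main.v *)
Require Import Defs.
From mathcomp Require Import all_boot all_order all_algebra.
From mathcomp Require Import reals complex.
Import Order.TTheory GRing.Theory Num.Theory.
Local Open Scope ring_scope.
Local Open Scope complex_scope.

(** By inclusion-exclusion over the sets S of vertices required to have no
    neighbour in D, and since the subsets of a set A contribute (1 + x) ^ |A| to a
    generating function by cardinality,
      D_t(G, x) = sum_S (-1)^|S| (1 + x)^(n - |N(S)|),
    where N(S) is the union of the neighbourhoods of the vertices of S.
    The term of the empty S is (1 + x)^n, and every other N(S) contains a whole
    neighbourhood, hence has at least delta elements.  At a root z put
    r = |z + 1|. If r <= 1 the bound is clear; otherwise each of the 2^n - 1
    other terms has modulus at most r^(n - delta), so
      r^n <= (2^n - 1) r^(n - delta),  that is  r^delta <= 2^n - 1. *)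

(** Expanding (x + 1) ^ |A| factor by factor chooses, for each element of A,
    whether it belongs to D. *)
Lemma sum_subset_exp (K : comNzRingType) (T : finType) (A : {set T}) (x : K) :
  \sum_(D : {set T} | D \subset A) x ^+ #|D| = (x + 1) ^+ #|A|.
Proof.
rewrite -prodr_const [RHS]big_mkcond /=.
have -> : \prod_(i : T) (if i \in A then x + 1 else 1)
        = \prod_(i : T) ((if i \in A then x else 0) + 1).
  by apply: eq_bigr => i _; case: ifP => // _; rewrite add0r.
rewrite bigA_distr [LHS]big_mkcond /=; apply: eq_bigr => D _.
case: ifP => [/subsetP sDA | /negbT /subsetPn [u uD uA]].
  rewrite -prodr_const big_mkcond /=; apply: eq_bigr => i _.
  by case: ifP => // /sDA ->.
by rewrite (bigD1 u) //= uD (negbTE uA) mul0r.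
Qed.

Section OpenNeighbourhoods.

Variables (V : finType) (adj : rel V).

Definition neighbourhood (v : V) : {set V} := [set u | adj v u].

Definition set_neighbourhood (S : {set V}) : {set V} :=
  \bigcup_(v in S) neighbourhood v.

(** No vertex of S is dominated by D exactly when D avoids N(S), which turns
    the expansion of the product of the factors 1 - [D misses N(v)] into a sum
    over S. *)
Lemma total_dominating_inclusion_exclusion (K : comNzRingType) (D : {set V}) :
  (total_dominating adj D)%:R
    = \sum_(S : {set V}) (-1) ^+ #|S| * (D \subset ~: set_neighbourhood S)%:R
    :> K.
Proof.
pose miss v : bool := D \subset ~: neighbourhood v.
have -> : (total_dominating adj D)%:R = \prod_(v : V) (- (miss v)%:R + 1) :> K.
  have domE v : [exists u in D, adj v u] = ~~ miss v.
    apply/idP/idP => [/exists_inP [u uD vu] | /subsetPn [u uD]].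
      by apply/subsetPn; exists u => //; rewrite !inE vu.
    by rewrite !inE negbK => vu; apply/exists_inP; exists u.
  case: (boolP (total_dominating adj D)) => [/forallP dom | ].
    by rewrite big1 // => v _; rewrite -[miss v]negbK -domE dom oppr0 add0r.
  case/forallPn => v; rewrite domE negbK => mv.
  by rewrite (bigD1 v) //= mv addNr mul0r.
rewrite bigA_distr; apply: eq_bigr => S _.
rewrite -big_mkcond /=.
have -> : (D \subset ~: set_neighbourhood S) = [forall v in S, miss v].
  rewrite -disjoints_subset disjoint_sym /set_neighbourhood.
  rewrite disjoints_subset; apply/bigcupsP/forall_inP => H v vS;
    by move: (H v vS); rewrite /miss -!disjoints_subset disjoint_sym.
case: (boolP [forall v in S, miss v]) => [/forall_inP H | ].
  rewrite mulr1 -prodr_const; apply: eq_bigr => v /H -> //.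
case/forall_inPn => v vS mv.
by rewrite mulr0 (bigD1 v) //= (negbTE mv) oppr0 mul0r.
Qed.

(** The sum defining the polynomial starts at i = 1, so the empty set has to
    be excluded; in a nonempty graph it dominates no vertex. *)
Lemma horner_total_dom_poly (K : comNzRingType) (x : K) :
  (0 < #|V|)%N ->
  (total_dom_poly K adj).[x]
    = \sum_(D : {set V} | total_dominating adj D) x ^+ #|D|.
Proof.
move=> /card_gt0P [v0 _].
have dom_gt0 D : total_dominating adj D -> (0 < #|D|)%N.
  by move/forallP/(_ v0)/exists_inP => [u uD _]; apply/card_gt0P; exists u.
rewrite /total_dom_poly big_add1 /= big_mkord horner_sum.
(* p D is |D| - 1 for dominating D, the index of the coefficient to which D
   contributes after the shift; since |D| - 1 < |V| the default is never reached. *)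
pose p (D : {set V}) : 'I_#|V| := insubd (enum_rank v0) #|D|.-1.
rewrite (partition_big p xpredT) //=; apply: eq_bigr => i _.
rewrite hornerZ hornerXn /num_total_dominating mulr_natl -sumr_const.
have pE D : total_dominating adj D -> (p D == i) = (#|D| == i.+1).
  move=> domD; rewrite -val_eqE /p val_insubd /=.
  have D_gt0 := dom_gt0 _ domD.
  by rewrite prednK // max_card -[in RHS](prednK D_gt0) eqSS.
apply: eq_big => D.
  by rewrite inE; case: (boolP (total_dominating adj D)) => //= domD; rewrite pE.
by rewrite inE => /andP [_ /eqP ->].
Qed.

(** After exchanging the two sums, the inner one runs over the subsets D of
    the complement of N(S). *)
Lemma total_dom_poly_inclusion_exclusion (K : comNzRingType) (x : K) :
  (0 < #|V|)%N ->
  (total_dom_poly K adj).[x]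
    = \sum_(S : {set V}) (-1) ^+ #|S| * (x + 1) ^+ #|~: set_neighbourhood S|.
Proof.
move=> V_gt0; rewrite horner_total_dom_poly // big_mkcond /=.
under eq_bigr => D _ do rewrite -mulrb -mulr_natl
  total_dominating_inclusion_exclusion mulr_suml.
rewrite exchange_big /=; apply: eq_bigr => S _.
rewrite -sum_subset_exp mulr_sumr [RHS]big_mkcond /=.
by apply: eq_bigr => D _; case: ifP => _; rewrite ?mulr1 ?mulr0 ?mul0r.
Qed.

Lemma min_degree_le_card : (min_degree adj <= #|V|)%N.
Proof.
by rewrite /min_degree -minEnat -leEnat; apply: bigmin_le_id.
Qed.

Lemma min_degree_le_set_neighbourhood (S : {set V}) :
  S != set0 -> (min_degree adj <= #|set_neighbourhood S|)%N.
Proof.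
case/set0Pn => v vS.
apply: (@leq_trans (degree adj v)); last first.
  by apply: subset_leq_card; apply: bigcup_sup.
by rewrite /min_degree -minEnat -leEnat; apply: bigmin_le.
Qed.

End OpenNeighbourhoods.

Theorem theorem3p2 (R : realType) (V : finType) (adj : rel V)
    (adj_sym : symmetric adj) (adj_irr : irreflexive adj)
    (n : nat) (order_n : #|V| = n)
    (delta : nat) (delta_min : min_degree adj = delta)
    (delta_gt0 : (0 < delta)%N)
    (z : R[i]) (z_root : root (total_dom_poly R[i] adj) z) :
  `|z + 1| <= delta.-root (2 ^+ n - 1).
Proof.
have le_delta_n : (delta <= n)%N.
  by rewrite -delta_min -order_n min_degree_le_card.
have n_gt0 : (0 < n)%N := leq_trans delta_gt0 le_delta_n.
have bound_ge1 : 1 <= 2 ^+ n - 1 :> R[i].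
  by rewrite lerBrDr -natrX -[1 + 1]/(2%:R) ler_nat -{1}(expn1 2) leq_exp2l.
set r := `|z + 1|.
have r_ge0 : 0 <= r by exact: normr_ge0.
rewrite -(exprCK delta_gt0 r_ge0) ler_rootC ?qualifE /= ?exprn_ge0 //;
  last by apply: le_trans bound_ge1.
have [r_le1 | r_gt1] := real_leP (ger0_real r_ge0) (real1 _).
  by apply: le_trans bound_ge1; apply: exprn_ile1.
have r_gt0 : 0 < r by apply: lt_trans r_gt1.
rewrite -(ler_pM2r (exprn_gt0 (n - delta) r_gt0)) -exprD subnKC //.
move: z_root; rewrite rootE total_dom_poly_inclusion_exclusion ?order_n //.
rewrite (bigD1 set0) //= cards0 mul1r /set_neighbourhood big_set0 setC0 cardsT.
rewrite order_n addr_eq0 => /eqP zE.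
rewrite /r -normrX zE normrN.
(* 2 ^ n counts the subsets of V: the generating function of all subsets by
   cardinality, taken at 1. *)
have -> : 2 ^+ n - 1 = \sum_(S : {set V} | S != set0) 1 :> R[i].
  rewrite -order_n -cardsT -[2]/(1 + 1) -sum_subset_exp.
  rewrite (bigD1 set0) ?sub0set //= expr1n [LHS]addrC addKr.
  by apply: eq_big => [S | S _]; rewrite ?subsetT ?expr1n.
rewrite mulr_suml; apply: le_trans (ler_norm_sum _ _ _) _.
apply: ler_sum => S S_neq0.
rewrite mul1r normrM normrX normrN1 expr1n mul1r normrX.
apply: ler_weXn2l; first exact: ltW.
rewrite cardsCs setCK order_n leq_sub2l // -delta_min.
exact: min_degree_le_set_neighbourhood.
Qed.
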